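(* Let $N\ge 1$ be an integer and for each $1\le i\le N$ let $s_i,t_i$ be points in $(\frac{i-1}{N},\frac iN]$. Then for each $p\ge 2$, each $R\gtrsim N^2$ (i.e. $R\ge cN^2$ for a fixed absolute constant $c>0$), each ball $B_R\subset\mathbb{R}^5$ of radius $R$ and each choice of $a_{i,j}\in\mathbb{C}$, $$\Big(\frac1{|B_R|}\int_{B_R}\Big|\sum_{i=1}^N\sum_{j=1}^N a_{i,j}\,e(x_1s_i+x_2t_j+x_3s_i^2+x_4t_j^2+x_5s_it_j)\Big|^p dx\Big)^{1/p}\lesssim D(N^2,p)\,\|a_{i,j}\|_{\ell^p(\{1,\dots,N\}^2)},$$ where the implicit constant does not depend on $N$, $R$, or the $a_{i,j}$.
   Context: $e(z)=e^{2\pi i z}$. For a square $S\subset[0,1]^2$ and $g:S\to\mathbb{C}$, $E_Sg(x)=\int_S g(s,t)e(x_1s+x_2t+x_3s^2+x_4t^2+x_5st)\,ds\,dt$. For a ball $B$ with center $c(B)$ and radius $R$, $w_B(x)=(1+|x-c(B)|/R)^{-100}$ and $\|f\|_{L^p(w_B)}=(\int|f|^pw_B)^{1/p}$. For $M\ge 1$, $D(M,p)$ is the smallest constant such that for all integrable $g:[0,1]^2\to\mathbb{C}$ and all balls $B_M\subset\mathbb{R}^5$ of radius $M$, $\|E_{[0,1]^2}g\|_{L^p(w_{B_M})}\le D(M,p)(\sum_\Delta\|E_\Delta g\|^p_{L^p(w_{B_M})})^{1/p}$, the sum running over a finitely overlapping cover of $[0,1]^2$ by squares $\Delta$ of side $M^{-1/2}$.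 *)

(* Defs.v *)
From HB Require Import structures.
From mathcomp Require Import all_boot all_order all_algebra.
From mathcomp Require Import all_classical all_reals all_analysis.
From mathcomp Require Import complex.
Set Implicit Arguments.
Unset Strict Implicit.
Unset Printing Implicit Defensive.
Import Order.TTheory GRing.Theory Num.Theory.
Import numFieldNormedType.Exports.
Local Open Scope classical_set_scope.
Local Open Scope ring_scope.

Section Decoupling.
Variable R : realType.

Definition leb1 := (@lebesgue_measure R).
Definition leb2 := (leb1 \x leb1)%E.
Definition leb5 := (leb1 \x (leb1 \x (leb1 \x (leb1 \x leb1))))%E.

Definition R5 := (R * (R * (R * (R * R))))%type.
Definition x1 (x : R5) : R := x.1.
Definition x2 (x : R5) : R := x.2.1.
Definition x3 (x : R5) : R := x.2.2.1.
Definition x4 (x : R5) : R := x.2.2.2.1.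
Definition x5 (x : R5) : R := x.2.2.2.2.

Definition dist5 (x c : R5) : R :=
  Num.sqrt ((x1 x - x1 c) ^+ 2 + (x2 x - x2 c) ^+ 2 + (x3 x - x3 c) ^+ 2
            + (x4 x - x4 c) ^+ 2 + (x5 x - x5 c) ^+ 2).

Definition ball5 (c : R5) (r : R) : set R5 := [set x | dist5 x c < r].

Definition cmod (z : R[i]) : R :=
  Num.sqrt (complex.Re z ^+ 2 + complex.Im z ^+ 2).

Definition ee (z : R) : R[i] := Complex (cos (2 * pi * z)) (sin (2 * pi * z)).

Definition phase (s t : R) (x : R5) : R :=
  x1 x * s + x2 x * t + x3 x * s ^+ 2 + x4 x * t ^+ 2 + x5 x * s * t.

Definition unit_square : set (R * R) :=
  [set z | 0 <= z.1 <= 1 /\ 0 <= z.2 <= 1].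

Definition cintegrable (g : R * R -> R[i]) : Prop :=
  leb2.-integrable unit_square (fun z => (complex.Re (g z))%:E) /\
  leb2.-integrable unit_square (fun z => (complex.Im (g z))%:E).

(** Extension operator E_S g (x), S a subset of [0,1]^2 (we integrate over
    S intersected with [0,1]^2, g being defined on [0,1]^2). *)
Definition extE (S : set (R * R)) (g : R * R -> R[i]) (x : R5) : R[i] :=
  Complex (Rintegral leb2 (S `&` unit_square)
     (fun z => complex.Re (g z * ee (phase z.1 z.2 x))))
  (Rintegral leb2 (S `&` unit_square)
     (fun z => complex.Im (g z * ee (phase z.1 z.2 x)))).

Definition wB (c : R5) (r : R) (x : R5) : R :=
  powR (1 + dist5 x c / r) (-100).

Definition Lpw (p : R) (c : R5) (r : R) (f : R5 -> R[i]) : \bar R :=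
  poweR (\int[leb5]_x (powR (cmod (f x)) p * wB c r x)%:E) p^-1.

(** The cover of [0,1]^2 by squares of side M^(-1/2): the grid squares
    [k d, (k+1) d] x [l d, (l+1) d], d = M^(-1/2), 0 <= k, l < ceil(1/d). *)
Definition side (M : R) : R := powR M (- 2^-1).
Definition ngrid (M : R) : nat := `|Num.ceil (side M)^-1|%N.
Definition gsquare (M : R) (k l : nat) : set (R * R) :=
  [set z | k%:R * side M <= z.1 <= k.+1%:R * side M /\
           l%:R * side M <= z.2 <= l.+1%:R * side M].

Definition dec_ineq (M p K : R) : Prop :=
  forall (g : R * R -> R[i]) (c : R5), cintegrable g ->
    (Lpw p c M (extE unit_square g) <=
     K%:E * poweR (\sum_(k < ngrid M) \sum_(l < ngrid M)
                     poweR (Lpw p c M (extE (gsquare M k l) g)) p) p^-1)%E.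

(** D(M, p): the smallest such constant (an infimum in the extended reals;
    +oo if no constant works). *)
Definition Ddec (M p : R) : \bar R :=
  ereal_inf [set K%:E | K in [set K : R | 0 <= K /\ dec_ineq M p K]].

Definition expsum (N : nat) (s t : 'I_N -> R) (a : 'I_N -> 'I_N -> R[i])
  (x : R5) : R[i] :=
  \sum_(i < N) \sum_(j < N) a i j * ee (phase (s i) (t j) x).

Definition avgLp (p : R) (c : R5) (r : R) (F : R5 -> R[i]) : \bar R :=
  poweR ((\int[leb5]_(x in ball5 c r) (powR (cmod (F x)) p)%:E)
         * (leb5 (ball5 c r))^-1) p^-1.

Definition lp_norm (N : nat) (p : R) (a : 'I_N -> 'I_N -> R[i]) : R :=
  powR (\sum_(i < N) \sum_(j < N) powR (cmod (a i j)) p) p^-1.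

End Decoupling.

(* Main.v *)
(** Put M = N^2.  The decoupling inequality is applied to the sum of a_ij times
    the normalized indicator of a tiny open square of side e with upper right
    corner (s_i, t_j).  That square lies in the grid cell (i, j) and meets no
    other one, so each |E_Delta g| is O(|a_ij|), while E g is uniformly close to
    the exponential sum F on any fixed ball of radius M once e is small.  As the
    weight w_B has integral O(M^5) and is bounded below on B, letting e tend to
    0 bounds the integral of |F|^p over any cube of side M/3 by
    O(M^5 D^p sum |a_ij|^p).  A ball of radius r >= M is covered by O((r/M)^5)
    such cubes and has volume comparable to r^5. *)

Require Import Defs.
From HB Require Import structures.
From mathcomp Require Import all_boot all_order all_algebra.
From mathcomp Require Import all_classical all_reals all_analysis.
From mathcomp Require Import measurable_realfun complex ring lra.
Import Order.TTheory GRing.Theory Num.Theory.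
Import numFieldNormedType.Exports.
Local Open Scope classical_set_scope.
Local Open Scope ring_scope.

Set Implicit Arguments.
Unset Strict Implicit.
Unset Printing Implicit Defensive.

(** The parameters lie in half-open intervals, so a point may sit on the right edge of its cell, and
    the closed grid cells share edges. An open square placed below and to the left of the point
    avoids both problems. The passage to small e never takes a limit of integrals. The integral over
    a cube is bounded up to an arbitrary additive error, and g is chosen after that error, since the
    decoupling bound sees g only through the numbers |a_ij|. The comparison |F| <= |E g| + eps is
    turned into one between p-th powers by discarding the part of |F|^p below (2 eps)^p, so that
    monotonicity of the integral is all that is asked of E g. Cubes serve as local domains because
    they tile and have explicit volume. Every estimate is made for a fixed admissible constant K.
    The infimum defining D enters only at the end. It may be +oo, so coefficients that all vanish
    are treated separately. *)

(** * Sigma-finiteness of product measures *)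

Section product_sigma_finite.
Local Open Scope ereal_scope.
Context d1 d2 (T1 : measurableType d1) (T2 : measurableType d2) (R : realType).
Variables (m1 : {sigma_finite_measure set T1 -> \bar R})
          (m2 : {sigma_finite_measure set T2 -> \bar R}).

(* The library gives [m1 \x m2] a sigma-finite structure only when both factors
   are subprobabilities, hence this alias. *)
Definition mprod : set (T1 * T2) -> \bar R := m1 \x m2.

HB.instance Definition _ := Measure.on mprod.

(** Products of two increasing exhaustions by sets of finite measure. Monotonicity lets the larger
    of two indices serve both coordinates. *)
Let mprod_sigma_finite : sigma_finite setT mprod.
Proof.
have /sigma_finiteP[F [FT Fnd Ffin]] := sigma_finiteT m1.
have /sigma_finiteP[G [GT Gnd Gfin]] := sigma_finiteT m2.
exists (fun n => F n `*` G n) => [|n].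
  apply/seteqP; split=> [[x y] _|//].
  have [m _ Fx] : (\bigcup_n F n) x by rewrite -FT.
  have [n _ Gy] : (\bigcup_n G n) y by rewrite -GT.
  exists (maxn m n) => //; split => /=.
    by have /subsetPset := Fnd _ _ (leq_maxl m n); exact.
  by have /subsetPset := Gnd _ _ (leq_maxr m n); exact.
have [[mF Fy] [mG Gy]] := (Ffin n, Gfin n).
split; first exact: measurableX.
by rewrite [X in X < _]product_measure1E// lte_mul_pinfty// ge0_fin_numE.
Qed.

HB.instance Definition _ :=
  Measure_isSigmaFinite.Build _ _ _ mprod mprod_sigma_finite.

Lemma mprodE (A : set T1) (B : set T2) :
  measurable A -> measurable B -> mprod (A `*` B) = m1 A * m2 B.
Proof. exact: product_measure1E. Qed.

End product_sigma_finite.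

Section lebesgue_instances.
Variable R : realType.
Let mR := measurableTypeR R.

(** The measures of the statement, rebundled with their sigma-finite structure so that the product
    formula can be iterated; the underlying set functions are convertible. *)
Definition lb1 : {sigma_finite_measure set mR -> \bar R} := @lebesgue_measure R.
Definition lb2 : {sigma_finite_measure set (mR * mR)%type -> \bar R} :=
  mprod lb1 lb1.
Definition lb5 :
    {sigma_finite_measure set (mR * (mR * (mR * (mR * mR))))%type -> \bar R} :=
  mprod lb1 (mprod lb1 (mprod lb1 lb2)).

Lemma leb5E : @leb5 R = lb5. Proof. by []. Qed.

End lebesgue_instances.

(** * Monotonicity and covering bounds for nonnegative integrals *)

Section nonnegative_integrals.
Local Open Scope ereal_scope.
Context d (T : measurableType d) (R : realType).
Variable mu : {measure set T -> \bar R}.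

(* No measurability is assumed, so that this applies to [extE], whose
   measurability in [x] is never needed. *)
Lemma ge0_le_integral_subset (A B : set T) (f g : T -> \bar R) :
  A `<=` B -> (forall x, A x -> 0 <= f x) -> (forall x, B x -> 0 <= g x) ->
  (forall x, A x -> f x <= g x) ->
  \int[mu]_(x in A) f x <= \int[mu]_(x in B) g x.
Proof.
move=> AB f0 g0 fg; rewrite !ge0_integralE//.
apply: ge_ereal_sup => _ [h /= hf <-]; apply: ereal_sup_ubound; exists h => // x.
apply: (le_trans (hf x)); rewrite /patch; case: ifPn => [/[!inE] Ax|_].
  by rewrite mem_set ?fg//; exact: AB.
by case: ifPn => [/[!inE]/g0|].
Qed.

(** On D the integrand is dominated by the sum of its restrictions to the pieces, which may overlap;
    each restriction integrates to at most A. *)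
Lemma integral_le_covering (I : finType) (Q : I -> set T) (D : set T)
    (f : T -> \bar R) (A : \bar R) :
  (forall i, measurable (Q i)) -> measurable_fun setT f -> (forall x, 0 <= f x) ->
  D `<=` \bigcup_i Q i -> (forall i, \int[mu]_(x in Q i) f x <= A) ->
  \int[mu]_(x in D) f x <= #|I|%:R%:E * A.
Proof.
move=> mQ mf f0 DQ QA.
have fQ0 i x : 0 <= (f \_ (Q i)) x by rewrite /patch; case: ifP.
apply: (@le_trans _ _ (\int[mu]_x \sum_(i <- enum I) (f \_ (Q i)) x)).
  apply: ge0_le_integral_subset => // [x _|x Dx]; first exact: sume_ge0.
  have [i _ Qi] := DQ _ Dx.
  rewrite big_enum/= (bigD1 i)//= {1}/patch mem_set// leeDl//.
  by apply: sume_ge0 => *.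
rewrite ge0_integral_sum//; last first.
  by move=> i; apply/(measurable_restrictT _ (mQ i)); exact: measurable_funTS.
rewrite big_enum/= (@le_trans _ _ (\sum_(i : I) A))//.
  by apply: lee_sum => i _; rewrite -integral_mkcond.
by rewrite sumr_const mule_natl.
Qed.

End nonnegative_integrals.

(** * Cubes and balls in dimension five *)

Section boxes.
Variable R : realType.
Local Notation mR := (measurableTypeR R).
Local Notation T5 := (mR * (mR * (mR * (mR * mR))))%type.

Lemma measurable_x1 : measurable_fun setT (@x1 R : T5 -> R).
Proof. exact: measurable_fst. Qed.

Lemma measurable_x2 : measurable_fun setT (@x2 R : T5 -> R).
Proof. exact: (measurableT_comp measurable_fst measurable_snd). Qed.

Lemma measurable_x3 : measurable_fun setT (@x3 R : T5 -> R).
Proof.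
apply: (measurableT_comp measurable_fst).
exact: (measurableT_comp measurable_snd measurable_snd).
Qed.

Lemma measurable_x4 : measurable_fun setT (@x4 R : T5 -> R).
Proof.
apply: (measurableT_comp measurable_fst).
apply: (measurableT_comp measurable_snd).
exact: (measurableT_comp measurable_snd measurable_snd).
Qed.

Lemma measurable_x5 : measurable_fun setT (@x5 R : T5 -> R).
Proof.
apply: (measurableT_comp measurable_snd).
apply: (measurableT_comp measurable_snd).
exact: (measurableT_comp measurable_snd measurable_snd).
Qed.

Lemma measurable_sqrt : measurable_fun setT (@Num.sqrt R).
Proof. by apply: continuous_measurable_fun; exact: sqrt_continuous. Qed.

Lemma measurable_dist5 (c : R5 R) :
  measurable_fun setT ((@dist5 R)^~ c : T5 -> R).
Proof.
apply: (measurableT_comp measurable_sqrt).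
repeat apply: measurable_funD; apply: measurable_funX; apply: measurable_funB => //.
- exact: measurable_x1.
- exact: measurable_x2.
- exact: measurable_x3.
- exact: measurable_x4.
- exact: measurable_x5.
Qed.

Lemma measurable_ball5 (c : R5 R) (r : R) : measurable (ball5 c r : set T5).
Proof.
rewrite -[X in measurable X]setTI.
rewrite [X in _ `&` X](_ : _ = ((@dist5 R)^~ c : T5 -> R) @^-1` `]-oo, r[%classic).
  exact: measurable_dist5.
by apply/seteqP; split => x /=; rewrite in_itv.
Qed.

(** The point c is the lowest corner. Half-open sides let translates by multiples of l tile a larger
    cube exactly. *)
Definition box (c : R5 R) (l : R) : set T5 :=
  `[x1 c, x1 c + l[%classic `*` (`[x2 c, x2 c + l[%classic `*`
  (`[x3 c, x3 c + l[%classic `*` (`[x4 c, x4 c + l[%classic `*`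
   `[x5 c, x5 c + l[%classic))).

Lemma measurable_box (c : R5 R) (l : R) : measurable (box c l).
Proof. by do 4 apply: measurableX => //. Qed.

Lemma leb5_box (c : R5 R) (l : R) : 0 <= l -> lb5 R (box c l) = (l ^+ 5)%:E.
Proof.
move=> l0.
have itvE (a : R) : lb1 R `[a, a + l[%classic = l%:E.
  rewrite /lb1/= lebesgue_measure_itv/= lte_fin ltrDl.
  have [l1|l1] := ltP 0 l; first by rewrite -EFinB addrC addKr.
  by congr (_%:E); apply/eqP; rewrite eq_le l0.
have prodE d (T : measurableType d) (m : {sigma_finite_measure set T -> \bar R})
    (B : set T) (a k : R) : measurable B -> m B = k%:E ->
    mprod (lb1 R) m (`[a, a + l[%classic `*` B) = (l * k)%:E.
  by move=> mB mBk; rewrite mprodE// mBk EFinM; congr (_ * _)%E; exact: itvE.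
(* Each round peels one interval off the nested product and one factor off the power. *)
do 4![rewrite exprS; apply: (prodE); first by do ?apply: measurableX].
by rewrite expr1; exact: itvE.
Qed.

(** The index is the integer part of (u - a) / l. *)
Lemma itv_cover (a l u : R) (n : nat) : 0 < l -> a <= u < a + n%:R * l ->
  exists k : 'I_n, a + k%:R * l <= u < a + k%:R * l + l.
Proof.
move=> l0 /andP[au un].
have ul0 : 0 <= (u - a) / l by rewrite divr_ge0 ?subr_ge0// ltW.
have /andP[k1 k2] := truncn_itv ul0.
have kn : (Num.truncn ((u - a) / l) < n)%N.
  by rewrite -(ltr_nat R) (le_lt_trans k1)// ltr_pdivrMr// ltrBlDl.
exists (Ordinal kn) => /=; move: k1 k2.
rewrite ler_pdivlMr// lerBrDl => ->/=.
by rewrite ltr_pdivrMr// ltrBlDl -natr1 mulrDl mul1r addrA.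
Qed.

Lemma box_cover (c : R5 R) (l : R) (n : nat) : 0 < l ->
  box c (n%:R * l) `<=` \bigcup_(k : 'I_n * ('I_n * ('I_n * ('I_n * 'I_n))))
    box (x1 c + k.1%:R * l, (x2 c + k.2.1%:R * l, (x3 c + k.2.2.1%:R * l,
        (x4 c + k.2.2.2.1%:R * l, x5 c + k.2.2.2.2%:R * l)))) l.
Proof.
move=> l0 [y1 [y2 [y3 [y4 y5]]]]; rewrite /box /= !in_itv/=.
move=> [/(itv_cover l0)[k1 h1] [/(itv_cover l0)[k2 h2] [/(itv_cover l0)[k3 h3]
  [/(itv_cover l0)[k4 h4] /(itv_cover l0)[k5 h5]]]]].
by exists (k1, (k2, (k3, (k4, k5)))) => //=; rewrite !in_itv.
Qed.

Lemma integral_box_le (c : R5 R) (l : R) (n : nat) (f : T5 -> \bar R)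
    (A : \bar R) : 0 < l ->
  measurable_fun setT f -> (forall x, 0 <= f x)%E ->
  (forall c', \int[lb5 R]_(x in box c' l) f x <= A)%E ->
  (\int[lb5 R]_(x in box c (n%:R * l)) f x <= (n%:R ^+ 5)%:E * A)%E.
Proof.
move=> l0 mf f0 fA.
have := integral_le_covering _ mf f0 (@box_cover c l n l0) _.
rewrite !card_prod !card_ord.
have -> : (n * (n * (n * (n * n))))%:R = n%:R ^+ 5 :> R.
  by rewrite !natrM !exprS expr0 mulr1.
by apply => // k; exact: measurable_box.
Qed.

Lemma ball5_sub_box (c : R5 R) (r : R) : ball5 c r `<=`
  box (x1 c - r, (x2 c - r, (x3 c - r, (x4 c - r, x5 c - r)))) (2 * r).
Proof.
have key (a u w : R) : 0 <= w -> Num.sqrt w < r -> (u - a) ^+ 2 <= w ->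
    u \in `[a - r, a - r + 2 * r[.
  move=> w0 wr uw.
  have : `|u - a| < r.
    by apply: le_lt_trans wr; rewrite -sqrtr_sqr ler_sqrt.
  rewrite ltr_norml in_itv/= => /andP[h1 h2]; apply/andP; split; lra.
move=> x; rewrite /ball5 /= /dist5; set w := _ + _ => wr.
have h1 := sqr_ge0 (x1 x - x1 c); have h2 := sqr_ge0 (x2 x - x2 c).
have h3 := sqr_ge0 (x3 x - x3 c); have h4 := sqr_ge0 (x4 x - x4 c).
have h5 := sqr_ge0 (x5 x - x5 c).
have w0 : 0 <= w by rewrite /w; lra.
split; first by apply: (key (x1 c) (x1 x) w) => //; rewrite /w; lra.
split; first by apply: (key (x2 c) (x2 x) w) => //; rewrite /w; lra.
split; first by apply: (key (x3 c) (x3 x) w) => //; rewrite /w; lra.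
split; first by apply: (key (x4 c) (x4 x) w) => //; rewrite /w; lra.
by apply: (key (x5 c) (x5 x) w) => //; rewrite /w; lra.
Qed.

(** The squared distance to the corner is at most 5 l^2 < 9 l^2 <= r^2. Positivity of l comes from
    the box containing a point. *)
Lemma box_sub_ball5 (c : R5 R) (l r : R) : 3 * l <= r -> box c l `<=` ball5 c r.
Proof.
move=> lr [y1 [y2 [y3 [y4 y5]]]]; rewrite /box /= !in_itv/=.
move=> [/andP[a1 b1] [/andP[a2 b2] [/andP[a3 b3] [/andP[a4 b4] /andP[a5 b5]]]]].
rewrite /ball5/= /dist5 /=.
have l0 : 0 < l by lra.
have r0 : 0 < r by lra.
rewrite -[ltRHS]ger0_norm ?ltW// -sqrtr_sqr ltr_sqrt ?exprn_gt0//.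
have sq (u v : R) : v <= u -> u < v + l -> (u - v) ^+ 2 <= l ^+ 2 by nra.
have := sq _ _ a1 b1; have := sq _ _ a2 b2; have := sq _ _ a3 b3.
have := sq _ _ a4 b4; have := sq _ _ a5 b5.
have : (3 * l) ^+ 2 <= r ^+ 2 by nra.
have : 0 < l ^+ 2 by rewrite exprn_gt0.
rewrite /x1/x2/x3/x4/x5/=; nra.
Qed.

End boxes.

(** * The weight: dyadic majorant and total mass *)

Section weight.
Variable R : realType.
Local Notation mR := (measurableTypeR R).
Local Notation T5 := (mR * (mR * (mR * (mR * mR))))%type.

Lemma dist5_ge0 (x c : R5 R) : 0 <= dist5 x c.
Proof. exact: sqrtr_ge0. Qed.

Lemma wB_ge0 (c : R5 R) (r : R) (x : R5 R) : 0 <= wB c r x.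
Proof. exact: powR_ge0. Qed.

(** The least n with u < 2^n works: for n > 0 minimality gives 2^(n-1) <= u, and for n = 0 the upper
    bound is trivial. *)
Lemma exists_dyadic (u : R) : exists n : nat, u < 2 ^+ n <= 2 * (1 + `|u|).
Proof.
have [n un] : exists n : nat, u < 2 ^+ n.
  exists (Num.truncn `|u|).+1; apply: (le_lt_trans (ler_norm u)).
  apply: (lt_trans (truncnS_gt `|u|)).
  by rewrite -natrX ltr_nat ltn_expl.
case: (ex_minnP (ex_intro (fun n => u < 2 ^+ n) n un)) => {un}n un nmin.
exists n; rewrite un/=; have u0 := normr_ge0 u; case: n un nmin => [|n] un nmin.
  by rewrite expr0; lra.
have /negP : ~ u < 2 ^+ n by move=> /nmin; rewrite ltnn.
rewrite -leNgt exprS => nu; have := ler_norm u; lra.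
Qed.

(** With u = 1 + |x - c| / r and 2^n <= 2 u, one has u^(-100) <= u^(-6) <= 64 * 2^(-6n). The
    exponent 6 exceeds the dimension by one, which leaves a summable factor 2^(-n) against the
    volume of the dyadic ball. *)
Lemma wB_le_dyadic (c : R5 R) (r : R) (x : R5 R) : 0 < r ->
  exists2 n : nat, ball5 c (2 ^+ n * r) x & wB c r x <= 64 * (2 ^+ n)^-1 ^+ 6.
Proof.
move=> r0; have d0 : 0 <= dist5 x c / r by rewrite divr_ge0 ?dist5_ge0// ltW.
have [n /andP[dn nd]] := exists_dyadic (dist5 x c / r); exists n.
  by rewrite /ball5/= -ltr_pdivrMr.
move: nd; rewrite ger0_norm// => nd; rewrite /wB.
set u := 1 + _ in nd *; have u1 : 1 <= u by rewrite /u; lra.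
have e0 : 0 < 2 ^+ n :> R by rewrite exprn_gt0.
apply: (@le_trans _ _ (u `^ (- 6%:R))).
  by rewrite ler_powR// lerN2 ler_nat.
rewrite powRN powR_mulrn; last lra.
have -> : 64 * (2 ^+ n)^-1 ^+ 6 = ((2^-1 * 2 ^+ n) ^+ 6)^-1 :> R.
  by field; rewrite gt_eqF.
have e1 : 0 < 2^-1 * 2 ^+ n :> R by rewrite mulr_gt0// invr_gt0.
have u0 : 0 < u by lra.
rewrite lef_pV2 ?posrE ?exprn_gt0//.
by apply: lerXn2r; rewrite ?nnegrE; lra.
Qed.

Lemma sum_half (n : nat) : \sum_(0 <= k < n) (2 ^+ k)^-1 <= 2 :> R.
Proof.
have -> : \sum_(0 <= k < n) (2 ^+ k)^-1 = 2 - 2 * (2 ^+ n)^-1 :> R.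
  elim: n => [|n ih]; first by rewrite big_geq// expr0 invr1; ring.
  have e0 : 0 < 2 ^+ n :> R by rewrite exprn_gt0.
  by rewrite big_nat_recr//= ih exprS; field; rewrite gt_eqF.
by rewrite gerBl mulr_ge0// invr_ge0 exprn_ge0.
Qed.

Lemma leb5_ball5_le (c : R5 R) (r : R) : 0 < r ->
  (lb5 R (ball5 c r) <= ((2 * r) ^+ 5)%:E)%E.
Proof.
move=> r0; have sub := @ball5_sub_box R c r.
have r2 : 0 <= 2 * r by lra.
rewrite -(leb5_box (x1 c - r, (x2 c - r, (x3 c - r, (x4 c - r, x5 c - r)))) r2).
apply: (le_measure (lb5 R) _ _ (sub : (_ : set T5) `<=` _)); rewrite inE.
- exact: measurable_ball5.
- exact: measurable_box.
Qed.

(** The weight is at most the sum over n of 64 * 2^(-6n) times the indicator of the ball of radius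
    2^n r, whose volume is at most 2^5 * 2^(5n) r^5. The n-th term thus integrates to at most 2^11 *
    r^5 * 2^(-n), and the geometric series contributes the last factor 2. *)
Lemma integral_wB_le (c : R5 R) (r : R) : 0 < r ->
  (\int[lb5 R]_x (wB c r x)%:E <= (2 ^+ 12 * r ^+ 5)%:E)%E.
Proof.
move=> r0.
pose k n : R := 64 * (2 ^+ n)^-1 ^+ 6.
have k0 n : 0 <= k n by rewrite mulr_ge0// exprn_ge0// invr_ge0 exprn_ge0.
pose h n (x : T5) := (k n * \1_(ball5 c (2 ^+ n * r) : set T5) x)%:E.
have h0 n x : (0 <= h n x)%E by rewrite lee_fin mulr_ge0.
have mh n : measurable_fun setT (h n).
  apply/measurable_EFinP; apply: measurable_funM => //.
  by apply: measurable_indic; exact: measurable_ball5.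
apply: (@le_trans _ _ (\int[lb5 R]_x \sum_(0 <= n <oo) h n x)%E).
  apply: ge0_le_integral_subset => // [x _|x _|x _].
  - by rewrite lee_fin wB_ge0.
  - by apply: nneseries_ge0 => n _ _; exact: h0.
  have [n xn wn] := wB_le_dyadic c x r0.
  apply: (@le_trans _ _ (\sum_(0 <= i < n.+1) h i x)%E); last first.
    by apply: nneseries_lim_ge => *; exact: h0.
  rewrite big_nat_recr//= (@le_trans _ _ (h n x))//; last first.
    by rewrite leeDr// sume_ge0.
  by rewrite /h lee_fin indicE mem_set// mulr1.
rewrite integral_nneseries//.
apply: (@le_trans _ _ (\sum_(0 <= n <oo) (2 ^+ 11 * r ^+ 5 * (2 ^+ n)^-1)%:E)%E).
  apply: lee_nneseries => [n _ _|n _]; first by apply: integral_ge0 => *; exact: h0.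
  rewrite /h; under eq_integral do rewrite EFinM.
  rewrite ge0_integralZl_EFin//; last first.
    apply/measurable_EFinP; apply: measurable_indic; exact: measurable_ball5.
  rewrite integral_indic//; last exact: measurable_ball5.
  have e0 : 0 < 2 ^+ n :> R by rewrite exprn_gt0.
  rewrite setIT (le_trans (lee_wpmul2l _ (leb5_ball5_le c _)))//.
  - by rewrite lee_fin.
  - by rewrite mulr_gt0.
  rewrite -EFinM lee_fin /k le_eqVlt; apply/orP; left; apply/eqP.
  by field; rewrite gt_eqF.
have t0 n : 0 <= 2 ^+ 11 * r ^+ 5 * (2 ^+ n)^-1.
  by rewrite !mulr_ge0 ?invr_ge0 ?exprn_ge0// ltW.
apply: lime_le.
  by apply: is_cvg_nneseries => n _ _; rewrite lee_fin.
apply: nearW => n; rewrite sumEFin lee_fin -mulr_sumr.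
have := sum_half n; have := exprn_gt0 5 r0; nra.
Qed.

End weight.

(** * Modulus, exponentials and the Lipschitz bound for the phase *)

Section modulus.
Variable R : realType.
Implicit Types (z w : R[i]) (x y : R).

Lemma cmodE z : cmod z = ComplexField.Normc.normc z.
Proof. by case: z. Qed.

Lemma cmod_ge0 z : 0 <= cmod z.
Proof. exact: sqrtr_ge0. Qed.

Lemma cmodM z w : cmod (z * w) = cmod z * cmod w.
Proof. by rewrite !cmodE ComplexField.Normc.normcM. Qed.

Lemma cmod_ee x : cmod (ee x) = 1.
Proof. by rewrite /cmod /ee /= cos2Dsin2 sqrtr1. Qed.

Lemma normr_Re_le z : `|complex.Re z| <= cmod z.
Proof. by rewrite -sqrtr_sqr ler_wsqrtr// lerDl sqr_ge0. Qed.

Lemma normr_Im_le z : `|complex.Im z| <= cmod z.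
Proof. by rewrite -sqrtr_sqr ler_wsqrtr// lerDr sqr_ge0. Qed.

Lemma cmod_le z : cmod z <= `|complex.Re z| + `|complex.Im z|.
Proof.
rewrite -[leRHS]ger0_norm ?addr_ge0// -sqrtr_sqr ler_wsqrtr//.
rewrite sqrrD !real_normK ?num_real// -addrA [_ *+ 2 + _]addrC addrA lerDl.
by rewrite mulrn_wge0// mulr_ge0.
Qed.

(** Closeness is asked of each part separately because [extE] is defined by two real integrals. *)
Lemma cmod_leD z w (e : R) : `|complex.Re w - complex.Re z| <= e ->
  `|complex.Im w - complex.Im z| <= e -> cmod z <= cmod w + 2 * e.
Proof.
move=> re im; rewrite -[z in leLHS](subrK w) !cmodE addrC.
apply: (le_trans (le_normcD _ _)); rewrite lerD2l -cmodE.
apply: (le_trans (cmod_le _)).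
case: z w re im => [a b] [a' b'] /= re im.
by rewrite [`|a - a'|]distrC [`|b - b'|]distrC; lra.
Qed.

Lemma cos_lipschitz x y : `|cos x - cos y| <= `|x - y|.
Proof.
wlog xy : x y / x < y => [hw|].
  have [xy|xy|->] := ltgtP x y; last by rewrite !subrr.
  - exact: hw.
  - by rewrite distrC [leRHS]distrC; exact: hw.
have [|c _ e] := MVT xy (fun u _ => is_derive_cos u).
  by apply: continuous_subspaceT; exact: continuous_cos.
rewrite distrC e normrM normrN [leRHS]distrC ler_piMl// ler_norml.
by rewrite sin_le1 sin_geN1.
Qed.

Lemma sin_lipschitz x y : `|sin x - sin y| <= `|x - y|.
Proof.
have -> : sin x - sin y = cos (pi / 2 - x) - cos (pi / 2 - y).
  by rewrite !cosB cos_pihalf sin_pihalf !mul0r !mul1r !add0r.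
apply: (le_trans (cos_lipschitz _ _)).
by rewrite opprB addrC addrA subrK distrC.
Qed.

Lemma ee_lipschitz x y : cmod (ee x - ee y) <= 4 * pi * `|x - y|.
Proof.
have pi2 : 2 * pi * `|x - y| = `|2 * pi * x - 2 * pi * y|.
  by rewrite -mulrBr normrM (@ger0_norm _ (2 * pi))// mulr_ge0// pi_ge0.
apply: (le_trans (cmod_le _)).
have := cos_lipschitz (2 * pi * x) (2 * pi * y).
have := sin_lipschitz (2 * pi * x) (2 * pi * y).
rewrite -pi2 /=; lra.
Qed.

(** The linear terms each cost B e. The factorizations s^2 - s'^2 = (s + s')(s - s') and s t - s' t'
    = s (t - t') + t' (s - s') make each of the three quadratic terms cost 2 B e, whence 8 = 1 + 1 +
    2 + 2 + 2. *)
Lemma phase_lipschitz (s t s' t' B e : R) (X : R5 R) :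
  `|s| <= 1 -> `|t| <= 1 -> `|s'| <= 1 -> `|t'| <= 1 ->
  `|s - s'| <= e -> `|t - t'| <= e ->
  `|x1 X| <= B -> `|x2 X| <= B -> `|x3 X| <= B -> `|x4 X| <= B -> `|x5 X| <= B ->
  `|phase s t X - phase s' t' X| <= 8 * B * e.
Proof.
move=> s1 t1 s1' t1' se te X1 X2 X3 X4 X5.
have e0 : 0 <= e := le_trans (normr_ge0 _) se.
have B0 : 0 <= B := le_trans (normr_ge0 _) X1.
have key (u v k : R) : `|u| <= B -> `|v| <= k * e -> `|u * v| <= k * (B * e).
  move=> uB vk; rewrite normrM mulrCA; apply: ler_pM => //.
have -> : phase s t X - phase s' t' X =
    x1 X * (s - s') + x2 X * (t - t') + x3 X * ((s + s') * (s - s')) +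
    x4 X * ((t + t') * (t - t')) + x5 X * (s * (t - t') + t' * (s - s')).
  by rewrite /phase; ring.
have two (u v w : R) : `|u| <= 1 -> `|v| <= 1 -> `|w| <= e -> `|(u + v) * w| <= 2 * e.
  move=> u1 v1 we; rewrite normrM; apply: ler_pM => //.
  by apply: (le_trans (ler_normD _ _)); lra.
have one (u w : R) : `|u| <= 1 -> `|w| <= e -> `|u * w| <= e.
  by move=> u1 we; rewrite normrM -[leRHS]mul1r; apply: ler_pM.
have st : `|s * (t - t') + t' * (s - s')| <= 2 * e.
  have := one _ _ s1 te; have := one _ _ t1' se.
  by have := ler_normD (s * (t - t')) (t' * (s - s')); lra.
have := key _ _ 1 X1; rewrite mul1r => /(_ _ se) k1.
have := key _ _ 1 X2; rewrite mul1r => /(_ _ te) k2.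
have k3 := key _ _ 2 X3 (two _ _ _ s1 s1' se).
have k4 := key _ _ 2 X4 (two _ _ _ t1 t1' te).
have k5 := key _ _ 2 X5 st.
have n5 (a b c d f : R) : `|a + b + c + d + f| <= `|a| + `|b| + `|c| + `|d| + `|f|.
  by do 4 (apply: (le_trans (ler_normD _ _)); rewrite lerD2r).
by apply: (le_trans (n5 _ _ _ _ _)); lra.
Qed.

End modulus.

(** * Bounds for real-valued integrals *)

Section Rintegral_bounds.
Context d (T : measurableType d) (R : realType).
Variable mu : {measure set T -> \bar R}.

Lemma normr_Rintegral_le (D : set T) (f h : T -> R) (k : R) :
  measurable D -> measurable_fun D f -> (forall x, D x -> `|f x| <= h x) ->
  (\int[mu]_(x in D) (h x)%:E <= k%:E)%E -> `|Rintegral mu D f| <= k.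
Proof.
move=> mD mf fh hk.
have : (`|\int[mu]_(x in D) (f x)%:E| <= k%:E)%E.
  apply: (le_trans (le_abse_integral mu mD _)); first exact/measurable_EFinP.
  by apply: (le_trans _ hk); apply: ge0_le_integral_subset => // x Dx;
    rewrite ?abse_ge0// lee_fin ?fh// (le_trans _ (fh _ Dx)).
by rewrite /Rintegral; case: integral => [r| |] //=; rewrite lee_fin.
Qed.

Lemma Rintegral_sum (I : Type) (s : seq I) (D : set T) (f : I -> T -> R) :
  measurable D -> (forall i, mu.-integrable D (EFin \o f i)) ->
  Rintegral mu D (fun x => \sum_(i <- s) f i x) =
  \sum_(i <- s) Rintegral mu D (f i).
Proof.
move=> mD fi; rewrite /Rintegral.
under eq_integral do rewrite -sumEFin.
rewrite (integral_sum mD fi) sum_fine// => i _.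
exact: (integrable_fin_num mD (fi i)).
Qed.

Lemma integrable_bounded (D : set T) (f : T -> R) (B : R) :
  measurable D -> (mu D < +oo)%E -> measurable_fun D f ->
  (forall x, `|f x| <= B) -> mu.-integrable D (EFin \o f).
Proof.
move=> mD Dy mf fB; apply: measurable_bounded_integrable => //.
by exists B; split; [exact: num_real|move=> M BM x _; exact/ltW/(le_lt_trans (fB x))].
Qed.

End Rintegral_bounds.

(** * Normalized indicators of small squares *)

Section bumps.
Variable R : realType.
Local Notation mR := (measurableTypeR R).
Local Notation T2 := (mR * mR)%type.
Implicit Types (P z : T2) (h : T2 -> R) (D : set T2) (e : R).

Lemma unit_squareE :
  @unit_square R = (`[0, 1]%classic : set R) `*` (`[0, 1]%classic : set R).
Proof. by apply/seteqP; split => -[a b] /=; rewrite !in_itv. Qed.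

Lemma measurable_unit_square : measurable (@unit_square R : set T2).
Proof. by rewrite unit_squareE; exact: measurableX. Qed.

Lemma leb2_unit_square : (lb2 R (@unit_square R) < +oo)%E.
Proof.
rewrite unit_squareE.
have itvE : lb1 R `[0, 1]%classic = 1%:E.
  by rewrite /lb1/= lebesgue_measure_itv/= lte_fin ltr01 -EFinB subr0.
have -> : lb2 R (`[0, 1]%classic `*` `[0, 1]%classic) = (1%:E * 1%:E)%E.
  by rewrite -[in RHS]itvE; exact: mprodE.
by rewrite mule1 ltry.
Qed.

Definition corner_square P e : set T2 :=
  `]P.1 - e, P.1[%classic `*` `]P.2 - e, P.2[%classic.

Lemma measurable_corner_square P e : measurable (corner_square P e).
Proof. exact: measurableX. Qed.

Lemma leb2_corner_square P e : 0 < e ->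
  lb2 R (corner_square P e) = (e ^+ 2)%:E.
Proof.
move=> e0.
have itvE (a : R) : lb1 R `]a - e, a[%classic = e%:E.
  rewrite /lb1/= lebesgue_measure_itv/= lte_fin gtrBl e0 -EFinB.
  by rewrite opprB addrC subrK.
transitivity (mprod (lb1 R) (lb1 R) (corner_square P e)) => //.
rewrite mprodE//.
by rewrite expr2 EFinM; congr (_ * _)%E; exact: itvE.
Qed.

Definition bump P e z : R := (e ^+ 2)^-1 * \1_(corner_square P e) z.

Lemma bump_ge0 P e z : 0 <= bump P e z.
Proof. by rewrite mulr_ge0// invr_ge0 sqr_ge0. Qed.

Lemma bump_le P e z : bump P e z <= (e ^+ 2)^-1.
Proof. by rewrite ler_piMr// ?invr_ge0 ?sqr_ge0// indicE; case: (_ \in _). Qed.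

Lemma bump_out P e z : ~ corner_square P e z -> bump P e z = 0.
Proof. by move=> Pz; rewrite /bump indicE memNset// mulr0. Qed.

Lemma measurable_bump P e D : measurable_fun D (bump P e).
Proof.
apply: measurable_funTS; apply: measurable_funM => //.
by apply: measurable_indic; exact: measurable_corner_square.
Qed.

Lemma integral_bump P e D : 0 < e -> measurable D ->
  (\int[lb2 R]_(z in D) (bump P e z)%:E =
   ((e ^+ 2)^-1)%:E * lb2 R (corner_square P e `&` D))%E.
Proof.
move=> e0 mD; rewrite /bump; under eq_integral do rewrite EFinM.
rewrite ge0_integralZl_EFin//.
- by rewrite integral_indic//; exact: measurable_corner_square.
- apply/measurable_EFinP; apply: measurable_indic.
  exact: measurable_corner_square.
- by rewrite invr_ge0 sqr_ge0.
Qed.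

Lemma integral_bump_le P e D : 0 < e -> measurable D ->
  (\int[lb2 R]_(z in D) (bump P e z)%:E <= 1)%E.
Proof.
move=> e0 mD; rewrite integral_bump//.
have e2 : 0 < e ^+ 2 by rewrite exprn_gt0.
rewrite -[leRHS](_ : ((e ^+ 2)^-1)%:E * (e ^+ 2)%:E = _)%E; last first.
  by rewrite -EFinM mulVf// gt_eqF.
rewrite lee_wpmul2l ?lee_fin ?invr_ge0 ?(ltW e2)// -(leb2_corner_square P e0).
have mP := measurable_corner_square P e.
apply: (le_measure (lb2 R) _ _ (@subIsetl _ (corner_square P e) D)).
  by rewrite inE; exact: measurableI.
by rewrite inE.
Qed.

Lemma Rintegral_bump P e D : 0 < e -> measurable D -> corner_square P e `<=` D ->
  Rintegral (lb2 R) D (bump P e) = 1.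
Proof.
move=> e0 mD PD; rewrite /Rintegral integral_bump//.
have e2 : 0 < e ^+ 2 by rewrite exprn_gt0.
by rewrite setIidl// leb2_corner_square// -EFinM /= mulVf// gt_eqF.
Qed.

Lemma integrable_bumpM P e D h B : measurable D -> (lb2 R D < +oo)%E ->
  measurable_fun D h -> (forall z, `|h z| <= B) ->
  (lb2 R).-integrable D (EFin \o (fun z => bump P e z * h z)).
Proof.
move=> mD Dy mh hB; apply: (integrable_bounded (B := (e ^+ 2)^-1 * B)) => //.
  by apply: measurable_funM => //; exact: measurable_bump.
move=> z; rewrite normrM ger0_norm ?bump_ge0//.
by apply: ler_pM; rewrite ?bump_ge0 ?bump_le.
Qed.

(** The bump has mass one on D, so C is itself the integral of C times the bump, and the difference
    of the two integrals is at most eta times that mass. *)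
Lemma Rintegral_bump_approx P e D h (B C eta : R) : 0 < e ->
  measurable D -> (lb2 R D < +oo)%E -> corner_square P e `<=` D ->
  measurable_fun D h -> (forall z, `|h z| <= B) ->
  (forall z, corner_square P e z -> `|h z - C| <= eta) -> 0 <= eta ->
  `|Rintegral (lb2 R) D (fun z => bump P e z * h z) - C| <= eta.
Proof.
move=> e0 mD Dy PD mh hB hC eta0.
have iC : (lb2 R).-integrable D (EFin \o (fun z => bump P e z * C)).
  by apply: (integrable_bumpM P e (B := `|C|)).
have ih := integrable_bumpM P e mD Dy mh hB.
have ib : (lb2 R).-integrable D (EFin \o bump P e).
  apply: (integrable_bounded (B := (e ^+ 2)^-1)) => //.
    exact: measurable_bump.
  by move=> z; rewrite ger0_norm ?bump_ge0 ?bump_le.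
have -> : C = Rintegral (lb2 R) D (fun z => bump P e z * C).
  by rewrite RintegralZr// Rintegral_bump// mul1r.
rewrite -RintegralB//; apply: (normr_Rintegral_le (h := fun z => eta * bump P e z)) => //.
- by apply: measurable_funB; apply: measurable_funM => //; exact: measurable_bump.
- move=> z Dz; rewrite -mulrBr normrM ger0_norm ?bump_ge0// mulrC.
  have [Pz|Pz] := pselect (corner_square P e z).
    by rewrite ler_wpM2r ?bump_ge0 ?hC.
  by rewrite bump_out// !mulr0.
under eq_integral do rewrite EFinM.
rewrite ge0_integralZl_EFin//; first last.
- by apply/measurable_EFinP; exact: measurable_bump.
- by move=> z _; rewrite lee_fin bump_ge0.
by rewrite -[leRHS]mule1 lee_wpmul2l ?lee_fin// integral_bump_le.
Qed.

End bumps.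

(** * The test function and its extension *)

Section test_function.
Variable R : realType.
Local Notation mR := (measurableTypeR R).
Local Notation T2 := (mR * mR)%type.

Definition testfun (I : finType) (P : I -> T2) (a : I -> R[i]) (e : R) (z : T2) :
  R[i] := \sum_p Complex (bump (P p) e z) 0 * a p.

Lemma measurable_phase (x : R5 R) :
  measurable_fun setT (fun z : T2 => phase z.1 z.2 x).
Proof.
have mS : measurable_fun setT (fst : T2 -> mR) by exact: measurable_fst.
have mT : measurable_fun setT (snd : T2 -> mR) by exact: measurable_snd.
rewrite /phase; repeat apply: measurable_funD.
- exact: measurable_funM.
- exact: measurable_funM.
- by apply: measurable_funM => //; exact: measurable_funX.
- by apply: measurable_funM => //; exact: measurable_funX.
- by apply: measurable_funM => //; exact: measurable_funM.
Qed.

Section real_linear_part.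
(* [L] stands for either [complex.Re] or [complex.Im]. *)
Variable L : R[i] -> R.
Hypothesis L_sum : forall (I : finType) (F : I -> R[i]),
  L (\sum_i F i) = \sum_i L (F i).
Hypothesis L_scale : forall (k : R) z, L (Complex k 0 * z) = k * L z.
Hypothesis L_le : forall z, `|L z| <= cmod z.
Hypothesis L_measurable : forall (d : measure_display) (T : measurableType d)
  (D : set T) (f : T -> R) (a : R[i]),
  measurable_fun D f -> measurable_fun D (fun z => L (a * ee (f z))).
Variables (I : finType) (P : I -> T2) (a : I -> R[i]) (e : R).
Hypothesis e0 : 0 < e.

Let L_testfun (x : R5 R) (z : T2) : L (testfun P a e z * ee (phase z.1 z.2 x)) =
  \sum_p bump (P p) e z * L (a p * ee (phase z.1 z.2 x)).
Proof.
by rewrite mulr_suml L_sum; apply: eq_bigr => p _; rewrite -mulrA L_scale.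
Qed.

Let measurable_term (p : I) (x : R5 R) (D : set T2) :
  measurable_fun D (fun z : T2 => L (a p * ee (phase z.1 z.2 x))).
Proof. by apply: L_measurable; apply: measurable_funTS; exact: measurable_phase. Qed.

Let term_le (p : I) (x : R5 R) (z : T2) :
  `|L (a p * ee (phase z.1 z.2 x))| <= cmod (a p).
Proof. by apply: (le_trans (L_le _)); rewrite cmodM cmod_ee mulr1. Qed.

(** Only the k-th bump is alive on D, so the integrand is at most |a_k| times a function of mass at
    most one. *)
Lemma L_extE_local (D : set T2) (k : I) (x : R5 R) : measurable D ->
  (forall p z, p != k -> D z -> ~ corner_square (P p) e z) ->
  `|Rintegral (lb2 R) D
     (fun z => L (testfun P a e z * ee (phase z.1 z.2 x)))| <= cmod (a k).
Proof.
move=> mD out; under eq_Rintegral do rewrite L_testfun.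
apply: (normr_Rintegral_le (h := fun z => cmod (a k) * bump (P k) e z)) => //.
- apply: measurable_sum => p; apply: measurable_funM => //.
  exact: measurable_bump.
- move=> z Dz; rewrite (bigD1 k)//= big1 ?addr0; last first.
    by move=> p pk; rewrite bump_out ?mul0r//; exact: out.
  by rewrite normrM ger0_norm ?bump_ge0// mulrC ler_wpM2r ?bump_ge0.
under eq_integral do rewrite EFinM.
rewrite ge0_integralZl_EFin//; first last.
- exact: cmod_ge0.
- by apply/measurable_EFinP; exact: measurable_bump.
- by move=> z _; rewrite lee_fin bump_ge0.
by rewrite -[leRHS]mule1 lee_wpmul2l ?lee_fin ?cmod_ge0// integral_bump_le.
Qed.

(** Each bump nearly evaluates its exponential at P_p, with error at most |a_p| eta; the errors are
    summed over p. *)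
Lemma L_extE_approx (D : set T2) (eta : R) (x : R5 R) : measurable D ->
  (lb2 R D < +oo)%E -> 0 <= eta ->
  (forall p, corner_square (P p) e `<=` D) ->
  (forall p z, corner_square (P p) e z ->
    cmod (ee (phase z.1 z.2 x) - ee (phase (P p).1 (P p).2 x)) <= eta) ->
  `|Rintegral (lb2 R) D (fun z => L (testfun P a e z * ee (phase z.1 z.2 x)))
    - L (\sum_p a p * ee (phase (P p).1 (P p).2 x))|
  <= (\sum_p cmod (a p)) * eta.
Proof.
move=> mD Dy eta0 PD close; under eq_Rintegral do rewrite L_testfun.
rewrite Rintegral_sum//; last first.
  by move=> p; apply: (integrable_bumpM _ _ mD Dy _ (term_le p x)).
(* Subtractivity follows from the two rules assumed of L: a sum indexed by [bool], and scaling by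
   -1. *)
have L_sub z w : L z - L w = L (z - w).
  have := @L_sum _ (fun b : bool => if b then z else Complex (-1) 0 * w).
  rewrite !big_bool/= L_scale mulN1r => <-; congr (L (_ + _)).
  by case: w => u v; apply/eqP; rewrite eq_complex/=; apply/andP; split; apply/eqP; ring.
rewrite L_sum -sumrB mulr_suml; apply: (le_trans (ler_norm_sum _ _ _)).
apply: ler_sum => p _.
apply: (Rintegral_bump_approx e0 mD Dy _ _ (term_le p x)) => // [z Pz|].
  rewrite L_sub -mulrBr; apply: (le_trans (L_le _)).
  by rewrite cmodM ler_wpM2l ?cmod_ge0 ?close.
by rewrite mulr_ge0 ?cmod_ge0.
Qed.

Lemma L_testfun_integrable (D : set T2) : measurable D -> (lb2 R D < +oo)%E ->
  (lb2 R).-integrable D (fun z => (L (testfun P a e z))%:E).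
Proof.
move=> mD Dy.
have E z : L (testfun P a e z) = \sum_p bump (P p) e z * L (a p).
  by rewrite /testfun L_sum; apply: eq_bigr => p _; rewrite L_scale.
apply: (integrable_bounded (f := fun z => L (testfun P a e z))
  (B := \sum_p (e ^+ 2)^-1 * cmod (a p))) => //.
  under eq_fun do rewrite E.
  by apply: measurable_sum => p; apply: measurable_funM => //; exact: measurable_bump.
move=> z; rewrite E; apply: (le_trans (ler_norm_sum _ _ _)).
apply: ler_sum => p _; rewrite normrM ger0_norm ?bump_ge0//.
by apply: ler_pM; rewrite ?bump_ge0 ?bump_le.
Qed.

End real_linear_part.

Lemma Re_sum (I : finType) (F : I -> R[i]) :
  complex.Re (\sum_i F i) = \sum_i complex.Re (F i).
Proof. by apply: big_morph => [[a b] [c d]|]. Qed.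

Lemma Im_sum (I : finType) (F : I -> R[i]) :
  complex.Im (\sum_i F i) = \sum_i complex.Im (F i).
Proof. by apply: big_morph => [[a b] [c d]|]. Qed.

Lemma Re_scale (k : R) z : complex.Re (Complex k 0 * z) = k * complex.Re z.
Proof. by case: z => a b /=; rewrite mul0r subr0. Qed.

Lemma Im_scale (k : R) z : complex.Im (Complex k 0 * z) = k * complex.Im z.
Proof. by case: z => a b /=; rewrite mul0r addr0. Qed.

Lemma measurable_Re_ee (d : measure_display) (T : measurableType d) (D : set T)
    (f : T -> R) (a : R[i]) :
  measurable_fun D f -> measurable_fun D (fun z => complex.Re (a * ee (f z))).
Proof.
move=> mf; case: a => u v /=; apply: measurable_funB; apply: measurable_funM => //.
  apply: (measurableT_comp (continuous_measurable_fun (@continuous_cos R))).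
  exact: measurable_funM.
apply: (measurableT_comp (continuous_measurable_fun (@continuous_sin R))).
exact: measurable_funM.
Qed.

Lemma measurable_Im_ee (d : measure_display) (T : measurableType d) (D : set T)
    (f : T -> R) (a : R[i]) :
  measurable_fun D f -> measurable_fun D (fun z => complex.Im (a * ee (f z))).
Proof.
move=> mf; case: a => u v /=; apply: measurable_funD; apply: measurable_funM => //.
  apply: (measurableT_comp (continuous_measurable_fun (@continuous_sin R))).
  exact: measurable_funM.
apply: (measurableT_comp (continuous_measurable_fun (@continuous_cos R))).
exact: measurable_funM.
Qed.

Section extension_operator.
Variables (I : finType) (P : I -> T2) (a : I -> R[i]) (e : R).
Hypothesis e0 : 0 < e.

Lemma cintegrable_testfun : cintegrable (testfun P a e).
Proof.
have mU := @measurable_unit_square R; have Uy := @leb2_unit_square R.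
split.
  exact: (L_testfun_integrable Re_sum Re_scale (@normr_Re_le R) P a e mU Uy).
exact: (L_testfun_integrable Im_sum Im_scale (@normr_Im_le R) P a e mU Uy).
Qed.

(** The factor 2 is the price of bounding real and imaginary parts separately. *)
Lemma cmod_extE_local (S : set T2) (k : I) (x : R5 R) : measurable S ->
  (forall p z, p != k -> S z -> ~ corner_square (P p) e z) ->
  cmod (extE S (testfun P a e) x) <= 2 * cmod (a k).
Proof.
move=> mS out; have mU := @measurable_unit_square R.
have mSU : measurable (S `&` @unit_square R : set T2) by exact: measurableI.
have outU p z : p != k -> (S `&` @unit_square R) z -> ~ corner_square (P p) e z.
  by move=> pk [Sz _]; exact: out.
apply: (le_trans (cmod_le _)); rewrite /extE/= mulr_natl mulr2n; apply: lerD.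
- exact: (L_extE_local Re_sum Re_scale (@normr_Re_le R) measurable_Re_ee a e0 x mSU outU).
- exact: (L_extE_local Im_sum Im_scale (@normr_Im_le R) measurable_Im_ee a e0 x mSU outU).
Qed.

Lemma cmod_extE_approx (eta : R) (x : R5 R) : 0 <= eta ->
  (forall p, corner_square (P p) e `<=` @unit_square R) ->
  (forall p z, corner_square (P p) e z ->
    cmod (ee (phase z.1 z.2 x) - ee (phase (P p).1 (P p).2 x)) <= eta) ->
  cmod (\sum_p a p * ee (phase (P p).1 (P p).2 x)) <=
  cmod (extE (@unit_square R) (testfun P a e) x) + 2 * ((\sum_p cmod (a p)) * eta).
Proof.
move=> eta0 PU close; have mU := @measurable_unit_square R.
have Uy := @leb2_unit_square R.
apply: cmod_leD; rewrite /extE/= setIid.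
- exact: (L_extE_approx Re_sum Re_scale (@normr_Re_le R)
    measurable_Re_ee a e0 mU Uy eta0 PU close).
- exact: (L_extE_approx Im_sum Im_scale (@normr_Im_le R)
    measurable_Im_ee a e0 mU Uy eta0 PU close).
Qed.

End extension_operator.

End test_function.

(** * Grid cells and the choice of the test function *)

Section grid.
Variable R : realType.
Local Notation mR := (measurableTypeR R).
Local Notation T2 := (mR * mR)%type.

Lemma side_sqr (N : nat) : (0 < N)%N -> side (N%:R ^+ 2 : R) = N%:R^-1.
Proof.
move=> N0; rewrite /side -powR_mulrn// -powRrM mulrN divff// powRN powRr1//.
Qed.

(** At scale M = N^2 the side is exactly 1/N and the ceiling rounds nothing, so the cells match the
    intervals containing the s_i and t_j. *)
Lemma ngrid_sqr (N : nat) : (0 < N)%N -> ngrid (N%:R ^+ 2 : R) = N.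
Proof.
move=> N0; rewrite /ngrid side_sqr// invrK.
by rewrite (@ceil_def _ _ (N : int))// lexx andbT intrB ltrBlDr ltrDl.
Qed.

Lemma measurable_gsquare (M : R) (k l : nat) : measurable (gsquare M k l : set T2).
Proof.
rewrite (_ : gsquare M k l =
  (`[k%:R * side M, k.+1%:R * side M]%classic : set R) `*`
  (`[l%:R * side M, l.+1%:R * side M]%classic : set R)).
  exact: measurableX.
by apply/seteqP; split => -[u v] /=; rewrite !in_itv.
Qed.

Lemma exists_lower_bound (I : finType) (f : I -> R) : (forall i, 0 < f i) ->
  exists2 e, 0 < e & forall i, e <= f i.
Proof.
move=> f0; exists (\big[Order.min/1]_i f i) => [|i]; last exact: bigmin_le.
by apply: lt_bigmin.
Qed.

(** After scaling by N, the open cell i and the closed cell k share a point only if i < k + 1 and k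
    < i + 1. Both strict inequalities come from the openness of the first cell. *)
Lemma ord_eq_of_cells (N : nat) (i k : nat) (u : R) : (0 < N)%N ->
  i%:R / N%:R < u -> u < i.+1%:R / N%:R ->
  k%:R * N%:R^-1 <= u <= k.+1%:R * N%:R^-1 -> i = k.
Proof.
move=> N0 h1 h2 /andP[h3 h4].
have N1 : 0 < N%:R :> R by rewrite ltr0n.
have iu : i%:R < u * N%:R by rewrite -ltr_pdivrMr.
have ui : u * N%:R < i.+1%:R by rewrite -ltr_pdivlMr.
have ku : k%:R <= u * N%:R by rewrite -ler_pdivrMr.
have uk : u * N%:R <= k.+1%:R by rewrite -ler_pdivlMr.
apply/eqP; rewrite eqn_leq; apply/andP; split.
- by rewrite -ltnS -(ltr_nat R) (lt_le_trans iu uk).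
- by rewrite -ltnS -(ltr_nat R) (le_lt_trans ku ui).
Qed.

(** The bound may depend on the center of the ball, since the bump width is chosen once the ball is
    fixed. *)
Lemma ball5_coord_le (c x : R5 R) (M : R) : ball5 c M x ->
  let B := `|x1 c| + `|x2 c| + `|x3 c| + `|x4 c| + `|x5 c| + M in
  [/\ `|x1 x| <= B, `|x2 x| <= B, `|x3 x| <= B, `|x4 x| <= B & `|x5 x| <= B].
Proof.
move=> /ball5_sub_box [h1 [h2 [h3 [h4 h5]]]] B.
have key (u v : R) : v - M <= u < v - M + 2 * M -> `|u| <= `|v| + M.
  move=> /andP[a b]; rewrite ler_norml; apply/andP; split.
    by have := ler_norm (- v); rewrite normrN; lra.
  by have := ler_norm v; lra.
have n1 := normr_ge0 (x1 c); have n2 := normr_ge0 (x2 c).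
have n3 := normr_ge0 (x3 c); have n4 := normr_ge0 (x4 c).
have n5 := normr_ge0 (x5 c).
move: h1 h2 h3 h4 h5; rewrite /= !in_itv/=.
move=> /key h1 /key h2 /key h3 /key h4 /key h5.
by split; [apply: (le_trans h1)|apply: (le_trans h2)|apply: (le_trans h3)|
  apply: (le_trans h4)|apply: (le_trans h5)]; rewrite /B; lra.
Qed.

(** The width e has two tasks: below every gap s_i - i/N and t_j - j/N it keeps each square inside
    its own cell, and below eps / D it keeps the exponentials nearly constant on each square,
    uniformly over the ball. *)
Lemma exists_testfun (N : nat) (s t : 'I_N -> R) (a : 'I_N -> 'I_N -> R[i])
    (c : R5 R) (M eps : R) : (0 < N)%N -> 0 < M -> 0 < eps ->
  (forall i : 'I_N, i%:R / N%:R < s i <= i.+1%:R / N%:R) ->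
  (forall i : 'I_N, i%:R / N%:R < t i <= i.+1%:R / N%:R) ->
  exists g : R * R -> R[i], [/\ cintegrable g,
    forall (k l : 'I_N) x,
      cmod (extE (gsquare (N%:R ^+ 2) k l) g x) <= 2 * cmod (a k l) &
    forall x, ball5 c M x ->
      cmod (expsum s t a x) <= cmod (extE (@unit_square R) g x) + eps].
Proof.
move=> N0 M0 eps0 hs ht; have N1 : 0 < N%:R :> R by rewrite ltr0n.
pose B := `|x1 c| + `|x2 c| + `|x3 c| + `|x4 c| + `|x5 c| + M.
have B0 : 0 <= B by rewrite /B !addr_ge0// ltW.
pose P (p : 'I_N * 'I_N) : T2 := (s p.1, t p.2).
pose b (p : 'I_N * 'I_N) := a p.1 p.2.
pose A := \sum_p cmod (b p).
have A0 : 0 <= A by apply: sumr_ge0 => p _; exact: cmod_ge0.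
have pi0 : 0 <= pi :> R := pi_ge0 R.
have [es es0 hes] : exists2 e, 0 < e & forall i, e <= s i - i%:R / N%:R.
  by apply: exists_lower_bound => i; rewrite subr_gt0; have /andP[] := hs i.
have [et et0 het] : exists2 e, 0 < e & forall i, e <= t i - i%:R / N%:R.
  by apply: exists_lower_bound => i; rewrite subr_gt0; have /andP[] := ht i.
(* Here 64 = 2 * 4 * 8: two parts of a complex number, the Lipschitz constant 4 pi of [ee], and 8 B
   from the phase. The added 1 keeps D positive when A or B vanishes. *)
pose D := 64 * pi * B * A + 1.
have D0 : 0 < D by rewrite /D ltr_wpDl// !mulr_ge0.
pose e := Num.min (Num.min es et) (eps / D).
have e0 : 0 < e by rewrite /e !lt_min es0 et0 divr_gt0.
have ees : e <= es by rewrite /e !ge_min lexx.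
have eet : e <= et by rewrite /e !ge_min lexx orbT.
have eD : e <= eps / D by rewrite /e !ge_min lexx orbT.
have cell (p : 'I_N * 'I_N) z : corner_square (P p) e z ->
    [/\ p.1%:R / N%:R < z.1, z.1 < p.1.+1%:R / N%:R,
        p.2%:R / N%:R < z.2 & z.2 < p.2.+1%:R / N%:R].
  rewrite /corner_square/= !in_itv/= => -[/andP[z1 z1'] /andP[z2 z2']].
  have := hes p.1; have := het p.2.
  have /andP[_ s1] := hs p.1; have /andP[_ t1] := ht p.2 => h1 h2.
  split; last exact: lt_le_trans t1.
  - lra.
  - exact: lt_le_trans s1.
  - lra.
have unit_cell (i : 'I_N) (u : R) : i%:R / N%:R < u -> u <= i.+1%:R / N%:R -> 0 <= u <= 1.
  move=> h1 h2; apply/andP; split.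
    by apply: (le_trans _ (ltW h1)); rewrite divr_ge0.
  apply: (le_trans h2); rewrite ler_pdivrMr// mul1r ler_nat; exact: ltn_ord.
have PU p : corner_square (P p) e `<=` @unit_square R.
  move=> z /cell[h1 h2 h3 h4]; split.
  - by apply: (unit_cell _ _ h1); exact: ltW.
  - by apply: (unit_cell _ _ h3); exact: ltW.
exists (testfun P b e); split.
- exact: cintegrable_testfun.
- move=> k l x.
  apply: (cmod_extE_local (k := (k, l)) b e0); first exact: measurable_gsquare.
  move=> p z pkl [/= zk zl] /cell[h1 h2 h3 h4].
  rewrite side_sqr// in zk zl.
  move/eqP: pkl; apply; case: p h1 h2 h3 h4 => i j /= h1 h2 h3 h4.
  by congr (_, _); apply: val_inj; [apply: (ord_eq_of_cells N0 h1 h2 zk)|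
    apply: (ord_eq_of_cells N0 h3 h4 zl)].
move=> x xB; have [X1 X2 X3 X4 X5] := ball5_coord_le xB.
rewrite (_ : expsum s t a x = \sum_p b p * ee (phase (P p).1 (P p).2 x)); last first.
  by rewrite /expsum pair_bigA.
apply: (le_trans (cmod_extE_approx (eta := 4 * pi * (8 * B * e)) b e0 _ PU _)).
- by rewrite !mulr_ge0// ltW.
- move=> p z pz; apply: (le_trans (ee_lipschitz _ _)).
  rewrite ler_wpM2l ?mulr_ge0//.
  have [/andP[u1 u2] /andP[u3 u4]] := PU _ _ pz.
  have /andP[s1 s2] := hs p.1; have /andP[s3 s4] := unit_cell _ _ s1 s2.
  have /andP[t1 t2] := ht p.2; have /andP[t3 t4] := unit_cell _ _ t1 t2.
  move: pz; rewrite /corner_square/= !in_itv/= => -[/andP[z1 z1'] /andP[z2 z2']].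
  have near (u v : R) : v - e < u -> u < v -> `|u - v| <= e.
    move=> h1 h2; rewrite distrC gtr0_norm ?subr_gt0//.
    by rewrite lerBlDl -lerBlDr ltW.
  by apply: phase_lipschitz => //=; (try exact: near); rewrite ger0_norm.
rewrite lerD2l -/A.
have -> : 2 * (A * (4 * pi * (8 * B * e))) = 64 * pi * B * A * e by ring.
apply: (@le_trans _ _ (D * e)); first by rewrite ler_wpM2r ?ltW// /D; lra.
by rewrite mulrC -ler_pdivlMr.
Qed.

End grid.

(** * The estimate on a cube of side M/3 *)

Section local_estimate.
Variable R : realType.
Local Notation mR := (measurableTypeR R).
Local Notation T5 := (mR * (mR * (mR * (mR * mR))))%type.

Lemma measurable_wB (c : R5 R) (r : R) :
  measurable_fun setT (wB c r : T5 -> R).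
Proof.
apply: (measurableT_comp (measurable_powR _)); apply: measurable_funD => //.
by apply: measurable_funM => //; exact: measurable_dist5.
Qed.

Lemma measurable_phase5 (s t : R) : measurable_fun setT (phase s t : T5 -> R).
Proof.
rewrite /phase; repeat apply: measurable_funD.
- by apply: measurable_funM => //; exact: measurable_x1.
- by apply: measurable_funM => //; exact: measurable_x2.
- by apply: measurable_funM => //; exact: measurable_x3.
- by apply: measurable_funM => //; exact: measurable_x4.
- by do 2 apply: measurable_funM => //; exact: measurable_x5.
Qed.

Lemma measurable_cmod_expsum (N : nat) (s t : 'I_N -> R)
    (a : 'I_N -> 'I_N -> R[i]) (p : R) :
  measurable_fun setT (fun x : T5 => cmod (expsum s t a x) `^ p).
Proof.
apply: (measurableT_comp (measurable_powR _)).
apply: (measurableT_comp (@measurable_sqrt R)).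
rewrite /expsum; under eq_fun do rewrite pair_bigA/= Re_sum Im_sum.
apply: measurable_funD; apply: measurable_funX; apply: measurable_sum => ij.
- by apply: measurable_Re_ee; exact: measurable_phase5.
- by apply: measurable_Im_ee; exact: measurable_phase5.
Qed.

Lemma wB_ge (c : R5 R) (r : R) (x : R5 R) : 0 < r -> ball5 c r x ->
  2 `^ (-100) <= wB c r x.
Proof.
rewrite /ball5/= /wB => r0 xr; rewrite !powRN lef_pV2 ?posrE ?powR_gt0//.
  apply: ge0_ler_powR; rewrite ?nnegrE//.
    by rewrite addr_ge0// divr_ge0 ?dist5_ge0// ltW.
  have : dist5 x c / r <= 1 by rewrite ler_pdivrMr// mul1r ltW.
  by lra.
by rewrite ltr_pwDl// divr_ge0 ?dist5_ge0// ltW.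
Qed.

(** If d <= g then f <= 2 g; otherwise f < 2 d and the left side is at most 0. *)
Lemma powR_le_of_leD (f g d p : R) : 0 < p -> 0 <= f -> 0 <= g -> 0 <= d ->
  f <= g + d -> f `^ p - (2 * d) `^ p <= 2 `^ p * g `^ p.
Proof.
move=> p0 f0 g0 d0 fgd.
have mono (u v : R) : 0 <= u -> u <= v -> u `^ p <= v `^ p.
  by move=> u0 uv; rewrite ge0_ler_powR ?nnegrE ?(le_trans u0 uv)// ltW.
have [dg|gd] := leP d g.
  have h : f `^ p <= (2 * g) `^ p by apply: mono => //; lra.
  by rewrite -powRM// lerBlDr (le_trans h)// lerDl powR_ge0.
have h : f `^ p <= (2 * d) `^ p by apply: mono => //; lra.
have k : 0 <= 2 `^ p * g `^ p by rewrite mulr_ge0 ?powR_ge0.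
by lra.
Qed.

Lemma poweR_invK (p : R) (X : \bar R) : p != 0 -> (0 <= X)%E ->
  ((X `^ p^-1) `^ p = X)%E.
Proof. by move=> p0 X0; rewrite -poweRrM mulVf// poweRe1. Qed.

(** The p-th power of the decoupling inequality: each cell contributes at most (2 |a_kl|)^p times
    the total mass of the weight. *)
Lemma integral_extE_le (N : nat) (p K : R) (a : 'I_N -> 'I_N -> R[i])
    (g : R * R -> R[i]) (c : R5 R) : (0 < N)%N -> 0 < p -> 0 <= K ->
  dec_ineq (N%:R ^+ 2) p K -> cintegrable g ->
  (forall (k l : 'I_N) x,
      cmod (extE (gsquare (N%:R ^+ 2) k l) g x) <= 2 * cmod (a k l)) ->
  (\int[lb5 R]_x (cmod (extE (@unit_square R) g x) `^ p * wB c (N%:R ^+ 2) x)%:E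
   <= (K `^ p * (2 `^ p * (2 ^+ 12 * (N%:R ^+ 2) ^+ 5)) *
      \sum_(k < N) \sum_(l < N) cmod (a k l) `^ p)%:E)%E.
Proof.
move=> N0 p0 K0 dec gi loc; have pn0 : p != 0 by rewrite gt_eqF.
have M0 : 0 < N%:R ^+ 2 :> R by rewrite exprn_gt0// ltr0n.
have ge0int S : (0 <= \int[lb5 R]_x
    (cmod (extE S g x) `^ p * wB c (N%:R ^+ 2) x)%:E)%E.
  by apply: integral_ge0 => x _; rewrite lee_fin mulr_ge0 ?powR_ge0.
have := dec g c gi; rewrite ngrid_sqr// => le.
pose Q := (2 `^ p * (2 ^+ 12 * (N%:R ^+ 2) ^+ 5) : R).
have Q0 : 0 <= Q by rewrite !mulr_ge0 ?powR_ge0 ?exprn_ge0.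
have piece (k l : 'I_N) : ((Lpw p c (N%:R ^+ 2)
    (extE (gsquare (N%:R ^+ 2) k l) g)) `^ p <= (Q * cmod (a k l) `^ p)%:E)%E.
  rewrite /Lpw leb5E poweR_invK//.
  apply: (@le_trans _ _ (\int[lb5 R]_x
      (((2 * cmod (a k l)) `^ p)%:E * (wB c (N%:R ^+ 2) x)%:E))%E).
    apply: ge0_le_integral_subset => // x _.
    - by rewrite lee_fin mulr_ge0 ?powR_ge0.
    - by rewrite -EFinM lee_fin mulr_ge0 ?powR_ge0.
    rewrite -EFinM lee_fin ler_wpM2r ?powR_ge0//.
    by rewrite ge0_ler_powR ?nnegrE ?mulr_ge0 ?cmod_ge0// ltW.
  rewrite ge0_integralZl_EFin ?powR_ge0//; first last.
  - by apply/measurable_EFinP; exact: measurable_wB.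
  - by move=> x _; rewrite lee_fin wB_ge0.
  apply: le_trans (lee_wpmul2l _ (integral_wB_le c M0)) _.
    by rewrite lee_fin powR_ge0.
  by rewrite -EFinM lee_fin powRM ?cmod_ge0// /Q mulrAC.
set S := \sum_(k < N) _.
have S0 : 0 <= S by do 2 (apply: sumr_ge0 => ? _); exact: powR_ge0.
have le2 : (Lpw p c (N%:R ^+ 2) (extE (@unit_square R) g)
    <= K%:E * ((Q * S)%:E `^ p^-1))%E.
  apply: (le_trans le); rewrite lee_wpmul2l ?lee_fin//.
  have pieces0 : (0 <= \sum_(k < N) \sum_(l < N) (Lpw p c (N%:R ^+ 2)
     (extE (gsquare (N%:R ^+ 2) k l) g)) `^ p)%E.
    by do 2 (apply: sume_ge0 => ? _); exact: poweR_ge0.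
  apply: gt0_ler_poweR; rewrite ?invr_ge0 ?(ltW p0) ?in_itv/= ?pieces0 ?leey//.
    by rewrite lee_fin mulr_ge0// leey.
  rewrite mulr_sumr -sumEFin; apply: lee_sum => k _.
  by rewrite mulr_sumr -sumEFin; apply: lee_sum => l _; exact: piece.
rewrite /Lpw leb5E in le2.
rewrite -[leLHS](poweR_invK pn0)//.
apply: (@le_trans _ _ ((K%:E * ((Q * S)%:E `^ p^-1)) `^ p)%E).
  apply: gt0_ler_poweR; first exact: ltW.
  - by rewrite in_itv/= leey andbT poweR_ge0.
  - by rewrite in_itv/= leey andbT mule_ge0// lee_fin powR_ge0.
  - exact: le2.
rewrite poweRM; [|by rewrite lee_fin|exact: poweR_ge0].
rewrite poweR_invK//; last by rewrite lee_fin mulr_ge0.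
by rewrite poweR_EFin -EFinM -[in leRHS]mulrA; exact: lexx.
Qed.

Lemma integral_box_expsum_le (N : nat) (p K : R) (s t : 'I_N -> R)
    (a : 'I_N -> 'I_N -> R[i]) (c : R5 R) : (0 < N)%N -> 0 < p -> 0 <= K ->
  dec_ineq (N%:R ^+ 2) p K ->
  (forall i : 'I_N, i%:R / N%:R < s i <= i.+1%:R / N%:R) ->
  (forall i : 'I_N, i%:R / N%:R < t i <= i.+1%:R / N%:R) ->
  (\int[lb5 R]_(x in box c (N%:R ^+ 2 / 3)) (cmod (expsum s t a x) `^ p)%:E
   <= (2 `^ p * 2 `^ 100 * (K `^ p * (2 `^ p * (2 ^+ 12 * (N%:R ^+ 2) ^+ 5)) *
      \sum_(k < N) \sum_(l < N) cmod (a k l) `^ p))%:E)%E.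
Proof.
move=> N0 p0 K0 dec hs ht.
have M0 : 0 < N%:R ^+ 2 :> R by rewrite exprn_gt0// ltr0n.
set M := N%:R ^+ 2 in dec M0 *; set A := K `^ p * _ * _.
have l0 : 0 < M / 3 by rewrite divr_gt0.
apply/lee_addgt0Pr => e e0.
(* Chosen so that the constant [delta] integrates to e over the cube; [eps] is then chosen so that
   (2 eps)^p equals [delta]. *)
pose delta := e / (M / 3) ^+ 5.
have delta0 : 0 < delta by rewrite divr_gt0// exprn_gt0.
pose eps := delta `^ p^-1 / 2.
have eps0 : 0 < eps by rewrite divr_gt0// powR_gt0.
have epsE : (2 * eps) `^ p = delta.
  by rewrite /eps mulrC divfK// -powRrM mulVf ?gt_eqF// powRr1// ltW.
have [g [gi loc approx]] := exists_testfun a c N0 M0 eps0 hs ht.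
(* Although g depends on [eps], this bound does not, so e may be arbitrarily small. *)
have main := integral_extE_le c N0 p0 K0 dec gi loc.
pose F (x : T5) := cmod (expsum s t a x) `^ p.
have mF : measurable_fun setT F by exact: measurable_cmod_expsum.
(* Truncating at [delta] absorbs the error [eps] without having to integrate a
   sum containing the possibly nonmeasurable [extE]. *)
pose h (x : T5) := Num.max (F x - delta) 0.
have mh D : measurable_fun D h.
  by apply: measurable_funTS; apply: measurable_maxr => //; exact: measurable_funB.
have h0 x : 0 <= h x by rewrite /h le_max lexx orbT.
have mbox := measurable_box c (M / 3).
(* The factor 2^p comes from separating E g from the error, and 2^100 inverts the lower bound of the
   weight on the ball of radius M. *)
pose k := 2 `^ p * 2 `^ 100 : R.
have k0 : 0 < k by rewrite mulr_gt0// powR_gt0.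
have hle : (\int[lb5 R]_(x in box c (M / 3)) (h x)%:E <= (k * A)%:E)%E.
  rewrite EFinM -lee_pdivrMl//.
  rewrite -ge0_integralZl_EFin ?invr_ge0 ?(ltW k0)//; first last.
  - exact/measurable_EFinP.
  - by move=> x _; rewrite lee_fin.
  apply: le_trans main; apply: ge0_le_integral_subset => //.
  - by move=> x _; rewrite -EFinM lee_fin mulr_ge0// invr_ge0 ltW.
  - by move=> x _; rewrite lee_fin mulr_ge0 ?powR_ge0.
  move=> x /(box_sub_ball5 (r := M)) xM; rewrite -EFinM lee_fin.
  have {}xM : ball5 c M x by apply: xM; rewrite mulrC divfK.
  rewrite mulrC ler_pdivrMr// /k.
  set E := cmod (extE _ _ _) `^ p.
  have E0 : 0 <= E by exact: powR_ge0.
  have w1 : 1 <= wB c M x * 2 `^ 100.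
    by rewrite -ler_pdivrMr ?powR_gt0// div1r -powRN wB_ge.
  have hE : h x <= 2 `^ p * E.
    rewrite /h ge_max mulr_ge0 ?powR_ge0// andbT -epsE.
    by apply: powR_le_of_leD => //; rewrite ?cmod_ge0 ?(ltW eps0) ?approx.
  apply: (le_trans hE).
  have -> : E * wB c M x * (2 `^ p * 2 `^ 100) = 2 `^ p * E * (wB c M x * 2 `^ 100).
    by ring.
  by rewrite ler_peMr// mulr_ge0 ?powR_ge0.
apply: (@le_trans _ _ (\int[lb5 R]_(x in box c (M / 3)) ((h x)%:E + delta%:E))%E).
  apply: ge0_le_integral_subset => // x _; rewrite -?EFinD lee_fin ?powR_ge0//.
    by rewrite addr_ge0// ltW.
  by rewrite -lerBlDr /h le_max lexx.
rewrite ge0_integralD//; first last.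
- by move=> x _; rewrite lee_fin ltW.
- exact/measurable_EFinP.
- by move=> x _; rewrite lee_fin.
have -> : e%:E = (delta%:E * lb5 R (box c (M / 3)))%E.
  by rewrite leb5_box ?(ltW l0)// -EFinM divfK// gt_eqF// exprn_gt0.
by rewrite leeD// integral_cst//; exact: lexx.
Qed.

End local_estimate.

(** * From cubes to balls, and averaging *)

Section global_estimate.
Variable R : realType.
Local Notation mR := (measurableTypeR R).
Local Notation T5 := (mR * (mR * (mR * (mR * mR))))%type.

Lemma box_subset (c : R5 R) (l l' : R) : l <= l' -> box c l `<=` box c l'.
Proof.
move=> ll'.
have sub (a : R) : `[a, a + l[%classic `<=` `[a, a + l'[%classic.
  by apply: subset_itvl; rewrite bnd_simp lerD2l.
move=> x [h1 [h2 [h3 [h4 h5]]]].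
by do 4 (split; first exact: sub); exact: sub.
Qed.

(* [21 = 7 * 3]: at most [(7 r / M) ^ 5] boxes cover a ball of radius [r], whose
   volume is at least [(r / 3) ^ 5]. *)
Definition dec_const (p : R) : R :=
  21 ^+ 5 * (2 `^ p * 2 `^ 100 * (2 `^ p * 2 ^+ 12)).

Lemma dec_const_gt0 (p : R) : 0 < dec_const p.
Proof. by rewrite !mulr_gt0 ?powR_gt0 ?exprn_gt0. Qed.

(** The bound is expressed through (r / 3)^5, the lower bound for the volume of the ball, so that
    this factor cancels in the average. *)
Lemma integral_ball5_expsum_le (N : nat) (p K : R) (s t : 'I_N -> R)
    (a : 'I_N -> 'I_N -> R[i]) (r : R) (c : R5 R) :
  (0 < N)%N -> 0 < p -> 0 <= K -> dec_ineq (N%:R ^+ 2) p K ->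
  (forall i : 'I_N, i%:R / N%:R < s i <= i.+1%:R / N%:R) ->
  (forall i : 'I_N, i%:R / N%:R < t i <= i.+1%:R / N%:R) ->
  N%:R ^+ 2 <= r ->
  (\int[lb5 R]_(x in ball5 c r) (cmod (expsum s t a x) `^ p)%:E <=
   (dec_const p * K `^ p * (\sum_(k < N) \sum_(l < N) cmod (a k l) `^ p) *
    (r / 3) ^+ 5)%:E)%E.
Proof.
move=> N0 p0 K0 dec hs ht Mr.
have M0 : 0 < N%:R ^+ 2 :> R by rewrite exprn_gt0// ltr0n.
have local c' := integral_box_expsum_le a c' N0 p0 K0 dec hs ht.
set S := \sum_(k < N) _ in local *.
have S0 : 0 <= S by do 2 (apply: sumr_ge0 => ? _); exact: powR_ge0.
set M := N%:R ^+ 2 in M0 Mr local dec *.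
have r0 : 0 < r by exact: lt_le_trans Mr.
have l0 : 0 < M / 3 by rewrite divr_gt0.
(* The enclosing cube has side 2 r = (6 r / M) (M / 3). Rounding up adds at most 1 <= r / M, which
   is where r >= M enters. *)
pose n := (Num.truncn (6 * r / M)).+1.
have rM0 : 0 <= 6 * r / M by rewrite divr_ge0 ?mulr_ge0// ltW.
have [n1 n2] : 6 * r / M <= n%:R /\ n%:R <= 7 * r / M.
  have /andP[h1 h2] := truncn_itv rM0; split; first exact: ltW.
  rewrite /n -natr1 (_ : 7 * r / M = 6 * r / M + r / M); last by ring.
  by rewrite lerD// ler_pdivlMr// mul1r.
pose c' : R5 R := (x1 c - r, (x2 c - r, (x3 c - r, (x4 c - r, x5 c - r)))).
have sub : ball5 c r `<=` box c' (n%:R * (M / 3)).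
  apply: (subset_trans (@ball5_sub_box R c r)); apply: box_subset.
  rewrite -ler_pdivrMr//; apply: le_trans n1; rewrite le_eqVlt; apply/orP; left.
  by apply/eqP; field; rewrite gt_eqF.
have mF := measurable_cmod_expsum s t a p.
apply: (@le_trans _ _ (\int[lb5 R]_(x in box c' (n%:R * (M / 3)))
    (cmod (expsum s t a x) `^ p)%:E)%E).
  by apply: ge0_le_integral_subset => // x _; rewrite lee_fin powR_ge0.
apply: (le_trans (integral_box_le c' n l0 _ _ local)).
- exact/measurable_EFinP.
- by move=> x; rewrite lee_fin powR_ge0.
rewrite -EFinM lee_fin; set A := (X in _ * X <= _).
have A0 : 0 <= A by rewrite /A !mulr_ge0 ?powR_ge0 ?exprn_ge0// ltW.
apply: (@le_trans _ _ ((7 * r / M) ^+ 5 * A)).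
  by rewrite ler_wpM2r// lerXn2r ?nnegrE// divr_ge0 ?mulr_ge0// ltW.
(* The scale M cancels: (7 r / M)^5 M^5 = 21^5 (r / 3)^5. *)
rewrite le_eqVlt; apply/orP; left; apply/eqP; rewrite /A /dec_const.
move: (2 `^ p) (2 `^ 100) (K `^ p) => u v w.
by field; rewrite gt_eqF.
Qed.

Lemma leb5_ball5_ge (c : R5 R) (r : R) : 0 < r ->
  (((r / 3) ^+ 5)%:E <= lb5 R (ball5 c r))%E.
Proof.
move=> r0; have r3 : 0 <= r / 3 by rewrite divr_ge0// ltW.
rewrite -(leb5_box c r3).
have sub : box c (r / 3) `<=` ball5 c r.
  by apply: box_sub_ball5; rewrite mulrC divfK.
apply: (le_measure (lb5 R) _ _ sub); rewrite inE.
- exact: measurable_box.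
- exact: measurable_ball5.
Qed.

Lemma avgLp_expsum_le (N : nat) (p K : R) (s t : 'I_N -> R)
    (a : 'I_N -> 'I_N -> R[i]) (r : R) (c : R5 R) :
  (0 < N)%N -> 0 < p -> 0 <= K -> dec_ineq (N%:R ^+ 2) p K ->
  (forall i : 'I_N, i%:R / N%:R < s i <= i.+1%:R / N%:R) ->
  (forall i : 'I_N, i%:R / N%:R < t i <= i.+1%:R / N%:R) ->
  N%:R ^+ 2 <= r ->
  (avgLp p c r (expsum s t a) <=
   (dec_const p `^ p^-1 * K * lp_norm p a)%:E)%E.
Proof.
move=> N0 p0 K0 dec hs ht Mr.
have M0 : 0 < N%:R ^+ 2 :> R by rewrite exprn_gt0// ltr0n.
have r0 : 0 < r by exact: lt_le_trans Mr.
have r3 : 0 < (r / 3) ^+ 5 by rewrite exprn_gt0// divr_gt0.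
have int_le := integral_ball5_expsum_le a c N0 p0 K0 dec hs ht Mr.
have ball_ge := leb5_ball5_ge c r0.
rewrite /avgLp /lp_norm leb5E.
set S := \sum_(k < N) _ in int_le *.
have S0 : 0 <= S by do 2 (apply: sumr_ge0 => ? _); exact: powR_ge0.
have C0 := ltW (dec_const_gt0 p).
set X := (\int[_]_(x in _) _)%E in int_le *; set Y := (lb5 R _) in ball_ge *.
have X0 : (0 <= X)%E by apply: integral_ge0 => x _; rewrite lee_fin powR_ge0.
have Y0 : (0 <= Y)%E by apply: le_trans ball_ge; rewrite lee_fin ltW.
have XY : (X * Y^-1 <= (dec_const p * K `^ p * S)%:E)%E.
  have YV : (Y^-1 <= (((r / 3) ^+ 5)^-1)%:E)%E.
    have -> : (((r / 3) ^+ 5)^-1)%:E = (((r / 3) ^+ 5)%R%:E^-1)%E.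
      by rewrite inver gt_eqF.
    by rewrite lee_pV2// inE lee_fin ltW.
  apply: (le_trans (lee_pmul X0 _ int_le YV)); first by rewrite inve_ge0.
  by rewrite -EFinM mulfK// gt_eqF.
apply: (@le_trans _ _ ((dec_const p * K `^ p * S)%:E `^ p^-1)%E).
  apply: gt0_ler_poweR; rewrite ?in_itv/= ?leey ?andbT ?invr_ge0 ?(ltW p0)//.
  - by rewrite mule_ge0// inve_ge0.
  - by rewrite lee_fin !mulr_ge0 ?powR_ge0.
rewrite poweR_EFin lee_fin !powRM ?mulr_ge0 ?powR_ge0//.
by rewrite -(powRrM K) divff ?gt_eqF// powRr1.
Qed.

(** A vanishing norm forces every coefficient to vanish. This settles the case in which the final
    bound cannot be divided by the norm. *)
Lemma avgLp_expsum0 (N : nat) (p : R) (s t : 'I_N -> R)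
    (a : 'I_N -> 'I_N -> R[i]) (r : R) (c : R5 R) : 0 < p ->
  lp_norm p a = 0 -> avgLp p c r (expsum s t a) = 0.
Proof.
move=> p0 /powR_eq0_eq0 S0.
have a0 i j : a i j = 0.
  have /psumr_eq0P/(_ S0)/(_ i isT)/eqP : forall k : 'I_N, true ->
      0 <= \sum_(l < N) cmod (a k l) `^ p.
    by move=> k _; apply: sumr_ge0 => l _; exact: powR_ge0.
  rewrite psumr_eq0 => [|l _]; last exact: powR_ge0.
  move=> /allP/(_ j (mem_index_enum _))/eqP/powR_eq0_eq0.
  by rewrite cmodE => /ComplexField.Normc.eq0_normc.
rewrite /avgLp leb5E integral0_eq ?mul0e ?poweR0r ?invr_neq0 ?gt_eqF// => x _.
rewrite /expsum big1 => [|i _]; last by rewrite big1// => j _; rewrite a0 mul0r.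
by rewrite cmodE ComplexField.Normc.normc0 powR0// gt_eqF.
Qed.

End global_estimate.

(** * From an admissible constant to the infimum [Ddec] *)

Unset Implicit Arguments.

Theorem theorem2p1 (R : realType) :
  exists c : R, 0 < c /\
  forall p : R, 2 <= p ->
  exists K : R, 0 < K /\
  forall (N : nat), (0 < N)%N ->
  forall (s t : 'I_N -> R),
    (forall i : 'I_N, i%:R / N%:R < s i <= i.+1%:R / N%:R) ->
    (forall i : 'I_N, i%:R / N%:R < t i <= i.+1%:R / N%:R) ->
  forall (r : R) (c0 : R5 R), c * N%:R ^+ 2 <= r ->
  forall a : 'I_N -> 'I_N -> R[i],
    (avgLp p c0 r (expsum s t a) <=
     K%:E * Ddec (N%:R ^+ 2) p * (lp_norm p a)%:E)%E.
Proof.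
exists 1; split=> // p p2; have p0 : 0 < p by apply: lt_le_trans p2.
have C0 : 0 < dec_const p `^ p^-1 by rewrite powR_gt0// dec_const_gt0.
exists (dec_const p `^ p^-1); split=> // N N0 s t hs ht r c0; rewrite mul1r => Mr a.
(* For zero norm the right side is 0 even if [Ddec] is +oo, by the convention that +oo times 0 is
   0. *)
have [lp0|lp0] := eqVneq (lp_norm p a) 0.
  by rewrite avgLp_expsum0// lp0 mule0.
have {}lp0 : 0 < lp_norm p a by rewrite lt_neqAle eq_sym lp0 powR_ge0.
(* Dividing by the positive finite factor isolates [Ddec], and it suffices to bound every admissible
   K from below; this is vacuous when there is none. *)
rewrite muleAC -EFinM -lee_pdivrMl ?mulr_gt0//.
apply: le_ereal_inf_tmp => _ [K [K0 dec] <-].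
rewrite lee_pdivrMl ?mulr_gt0// -EFinM mulrAC.
exact: avgLp_expsum_le.
Qed.
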